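(* Let $\mathbb{F}$ be any field with algebraic closure $\overline{\mathbb{F}}$, and let $\ell,m\ge1$ be integers. Let $$\mathsf{K}_{m,\ell}:\ \big(\mathrm{Sym}^{\ell m}(\mathbb{F}^{\ell\times\ell\times2})\big)^{\mathrm{SL}_\ell(\overline{\mathbb{F}})\times\mathrm{SL}_\ell(\overline{\mathbb{F}})}\ \longrightarrow\ \mathrm{Sym}^m\,\mathrm{Sym}_\ell(\mathbb{F}^2)$$ be the isomorphism of $\mathbb{F}$-vector spaces obtained by restricting to the degree $m$ homogeneous components the isomorphism of graded $\mathbb{F}$-algebras $\mathsf{K}_\ell$ determined by $\mathsf{K}_\ell(M_\ell(k))=F(k)$ for $0\le k\le \ell$. Then $\mathsf{K}_{m,\ell}$ is an isomorphism of $\mathrm{GL}_2(\mathbb{F})$-representations.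
   Context: Write $\mathbb{F}^{\ell\times\ell\times 2}:=\mathbb{F}^\ell\otimes\mathbb{F}^\ell\otimes\mathbb{F}^2$, and similarly over $\overline{\mathbb{F}}$; fix the embedding $\mathbb{F}\subseteq\overline{\mathbb{F}}$, so that $\mathrm{Sym}^d(\mathbb{F}^{\ell\times\ell\times2})\subseteq \mathrm{Sym}^d(\overline{\mathbb{F}}^{\ell\times\ell\times2})$. Here $\mathrm{Sym}^d$ denotes the $d$-th symmetric power, and $\mathrm{Sym}_d W=(\bigotimes^d W)^{\mathfrak{S}_d}$ denotes the space of symmetric tensors. The group $\mathrm{GL}_\ell(\overline{\mathbb{F}})\times\mathrm{GL}_\ell(\overline{\mathbb{F}})\times\mathrm{GL}_2(\overline{\mathbb{F}})$ acts $\overline{\mathbb{F}}$-linearly on $\overline{\mathbb{F}}^{\ell\times\ell\times2}$ by $(g_1,g_2,g_3)(v_1\otimes v_2\otimes v_3)=g_1v_1\otimes g_2v_2\otimes g_3v_3$, and hence on $\mathrm{Sym}^d(\overline{\mathbb{F}}^{\ell\times\ell\times2})$. The group $\mathrm{SL}_\ell(\overline{\mathbb{F}})\times\mathrm{SL}_\ell(\overline{\mathbb{F}})$ acts through the first two factors, and $\mathrm{GL}_2(\mathbb{F})$ acts through the third factor. By definition $$\big(\mathrm{Sym}^d(\mathbb{F}^{\ell\times\ell\times2})\big)^{\mathrm{SL}_\ell(\overline{\mathbb{F}})\times\mathrm{SL}_\ell(\overline{\mathbb{F}})}:=\big(\mathrm{Sym}^d(\overline{\mathbb{F}}^{\ell\times\ell\times2})\big)^{\mathrm{SL}_\ell(\overline{\mathbb{F}})\times\mathrm{SL}_\ell(\overline{\mathbb{F}})}\cap\mathrm{Sym}^d(\mathbb{F}^{\ell\times\ell\times2}),$$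 which is a $\mathrm{GL}_2(\mathbb{F})$-representation over $\mathbb{F}$. The group $\mathrm{GL}_2(\mathbb{F})$ acts on $\mathrm{Sym}^m\mathrm{Sym}_\ell(\mathbb{F}^2)$ in the way induced from its standard action on $\mathbb{F}^2$. Let $\{x,y\}$ be the basis of $\mathbb{F}^2$. For $0\le k\le\ell$ let $F(k)\in\mathrm{Sym}_\ell\mathbb{F}^2$ be the sum of all distinct tensors in the $\mathfrak{S}_\ell$-orbit of $x^{\otimes k}\otimes y^{\otimes(\ell-k)}$. Let $\det_\ell\in\mathrm{Sym}^\ell(\mathbb{F}^\ell\otimes\mathbb{F}^\ell)$ be the determinant polynomial $\sum_{\pi\in\mathfrak{S}_\ell}\mathrm{sgn}(\pi)\prod_{i}x_{i,\pi(i)}$ with $x_{i,j}=e_i\otimes e_j$. For vector spaces $V,W$ let $\boxtimes:\mathrm{Sym}^dV\times\mathrm{Sym}_dW\to\mathrm{Sym}^d(V\otimes W)$ be the well-defined bilinear map sending $([a],b)$, with $a\in\bigotimes^dV$ and $b\in(\bigotimes^dW)^{\mathfrak{S}_d}$, to the class of the image of $(a,b)$ under the standard bilinear map $\bigotimes^dV\times\bigotimes^dW\to\bigotimes^d(V\otimes W)$. Define $M_\ell(k):=\det_\ell\boxtimes F(k)\in\mathrm{Sym}^\ell(\mathbb{F}^{\ell\times\ell\times2})$. Equivalently, $M_\ell(k)$ is the coefficient of $t^k$ in $\det(tX+Y)$, where $X=(e_i\otimes e_j\otimes x)_{i,j}$ and $Y=(e_i\otimes e_j\otimes y)_{i,j}$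 are $\ell\times\ell$ matrices of independent variables of the polynomial ring $\mathrm{Sym}^\bullet(\mathbb{F}^{\ell\times\ell\times2})$. The elements $M_\ell(0),\dots,M_\ell(\ell)$ are algebraically independent invariants generating the algebra of all invariants $\bigoplus_d\big(\mathrm{Sym}^{d}(\mathbb{F}^{\ell\times\ell\times2})\big)^{\mathrm{SL}_\ell(\overline{\mathbb{F}})\times\mathrm{SL}_\ell(\overline{\mathbb{F}})}$. This algebra is re-graded so that its degree $m$ component is $\big(\mathrm{Sym}^{\ell m}(\mathbb{F}^{\ell\times\ell\times2})\big)^{\mathrm{SL}_\ell(\overline{\mathbb{F}})\times\mathrm{SL}_\ell(\overline{\mathbb{F}})}$, and $\mathsf{K}_\ell$ is the graded $\mathbb{F}$-algebra homomorphism from it to $\mathrm{Sym}^\bullet\mathrm{Sym}_\ell(\mathbb{F}^2)$ given on generators by $M_\ell(k)\mapsto F(k)$. Concretely, $\mathsf{K}_{m,\ell}$ is the $\mathbb{F}$-linear map with $\prod_{i=1}^mM_\ell(\lambda_i)\mapsto\prod_{i=1}^mF(\lambda_i)$ for all $\ell\ge\lambda_1\ge\cdots\ge\lambda_m\ge0$. *)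

(* Defs.v *)
From HB Require Import structures.
From mathcomp Require Import all_boot all_order all_fingroup all_algebra.
From mathcomp Require Import mpoly boolp.

Set Implicit Arguments.
Unset Strict Implicit.
Unset Printing Implicit Defensive.

Import GRing.Theory.
Local Open Scope ring_scope.

(* For a vector space W with a basis b_0, ..., b_(n-1), the symmetric algebra *)
(* of W is the polynomial ring {mpoly F[n]}, with b_r as the variable 'X_r,   *)
(* and its symmetric power of degree d is dhomog n F d. The endomorphism of W *)
(* with matrix A, b_r |-> \sum_s A s r b_s, acts on it by substitution.       *)
Section SymmetricPowerAction.
Context (F : fieldType) (n : nat).

Definition symact (A : 'M[F]_n) (p : {mpoly F[n]}) : {mpoly F[n]} :=
  p \mPo [tuple \sum_s A s r *: 'X_s | r < n].

HB.instance Definition _ A := GRing.LRMorphism.copy (symact A)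
  (@comp_mpoly n F n [tuple \sum_s A s r *: 'X_s | r < n]).

Lemma symactX A r : symact A 'X_r = \sum_s A s r *: 'X_s.
Proof. by rewrite /symact comp_mpolyXU -tnth_nth tnth_mktuple. Qed.

Lemma lrmorph_ext (S : comAlgType F) (f g : {lrmorphism {mpoly F[n]} -> S}) :
  (forall r, f 'X_r = g 'X_r) -> f =1 g.
Proof.
move=> fg p; rewrite (mpolyE p) !linear_sum; apply: eq_bigr => m _.
rewrite !linearZ; congr (_ *: _).
rewrite mpolyXE_id !rmorph_prod; apply: eq_bigr => r _.
by rewrite !rmorphXn; congr (_ ^+ _); apply: fg.
Qed.

Lemma symact1 p : symact 1%:M p = p.
Proof.
rewrite -[RHS]/(idfun p); apply: lrmorph_ext => r; rewrite /= symactX.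
rewrite (bigD1 r) //= mxE eqxx scale1r big1 ?addr0 // => s /negPf srF.
by rewrite mxE srF scale0r.
Qed.

Lemma symactM A B p : symact (A *m B) p = symact A (symact B p).
Proof.
rewrite -[RHS]/((symact A \o symact B) p); apply: lrmorph_ext => r /=.
rewrite !symactX linear_sum.
under [RHS]eq_bigr => t _.
  rewrite linearZ /= symactX scaler_sumr.
  under eq_bigr do rewrite scalerA mulrC.
  over.
rewrite exchange_big; apply: eq_bigr => s _.
by rewrite mxE scaler_suml.
Qed.

Lemma symact_homog A d p : p \is d.-homog -> symact A p \is d.-homog.
Proof.
move=> /dhomogP hp; rewrite (mpolyE p) linear_sum big_seq.
apply: rpred_sum => m /hp <-; rewrite linearZ; apply: rpredZ.
rewrite /= /symact comp_mpolyX.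
have -> : mdeg m = (\sum_(i <- [tuple m i | i < n]) i)%N.
  by rewrite mdegE big_tuple; apply: eq_bigr => i _; rewrite tnth_mktuple.
pose T := [tuple tnth [tuple \sum_s A s r *: 'X_s | r < n] i ^+ m i | i < n].
have -> : \prod_i tnth [tuple \sum_s A s r *: 'X_s | r < n] i ^+ m i
          = \prod_(q <- T) q :> {mpoly F[n]}.
  by rewrite big_tuple; apply: eq_bigr => i _; rewrite [in RHS]tnth_mktuple.
apply: dhomog_prod => i; rewrite !tnth_mktuple -[X in X.-homog]mul1n.
apply: dhomogMn; apply: rpred_sum => s _; apply: rpredZ.
by rewrite dhomogX /= mdeg1.
Qed.

End SymmetricPowerAction.

Lemma map_symact (F K : fieldType) (f : {rmorphism F -> K}) n (A : 'M[F]_n) p :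
  map_mpoly f (symact A p) = symact (map_mx f A) (map_mpoly f p).
Proof.
elim/mpolyind: p => [|c m p _ _ IH]; first by rewrite !raddf0.
have -> : symact A (c *: 'X_[m] + p) = c *: symact A 'X_[m] + symact A p.
  exact: linearP.
rewrite !raddfD /= IH; congr (_ + _).
rewrite !map_mpolyZ map_mpolyX.
have -> : symact (map_mx f A) (f c *: 'X_[m]) = f c *: symact (map_mx f A) 'X_[m].
  exact: linearZ.
congr (_ *: _); rewrite mpolyXE_id [in RHS]mpolyXE_id !rmorph_prod.
apply: eq_bigr => r _ /=.
have XE (L : fieldType) (B : 'M[L]_n) k : symact B ('X_r ^+ k) = symact B 'X_r ^+ k.
  exact: rmorphXn.
rewrite !XE !symactX; have -> q k : map_mpoly f (q ^+ k) = map_mpoly f q ^+ k.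
  exact: rmorphXn.
congr (_ ^+ _); rewrite raddf_sum; apply: eq_bigr => s _.
by rewrite /= map_mpolyZ map_mpolyX mxE.
Qed.

(* The space F^I with basis e_i, i : I, and its tensor powers: the tensor t   *)
(* is \sum_w t w e_(w 0) (x) ... (x) e_(w (d-1)), the sum being over words w. *)
Section Tensors.
Context (F : fieldType).

Definition tens (d : nat) (I : finType) := {ffun {ffun 'I_d -> I} -> F^o}.

Definition etens d (I : finType) (w : {ffun 'I_d -> I}) : tens d I := [ffun v => (v == w)%:R].

Definition permw d (I : finType) (s : 'S_d) (w : {ffun 'I_d -> I}) :
  {ffun 'I_d -> I} := [ffun i => w (s i)].

Definition permt d (I : finType) (s : 'S_d) (t : tens d I) : tens d I :=
  [ffun w => t (permw s w)].

Fact permt_is_linear d (I : finType) s : linear (@permt d I s).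
Proof. by move=> a t u; apply/ffunP => w; rewrite !ffunE. Qed.
HB.instance Definition _ d I s :=
  GRing.isLinear.Build F (tens d I) (tens d I) _ (permt s)
    (@permt_is_linear d I s).

Definition symtens d (I : finType) : {vspace tens d I} :=
  (\bigcap_(s : 'S_d) fixedSpace (linfun (permt s)))%VS.

Lemma symtensP d (I : finType) (t : tens d I) :
  reflect (forall s w, t (permw s w) = t w) (t \in symtens d I).
Proof.
apply: (iffP idP) => [tS s w|tS].
  have /fixedSpaceP : t \in fixedSpace (linfun (permt s)).
    by move: tS; rewrite memvE => /subv_bigcapP/(_ s isT); rewrite -memvE.
  by rewrite lfunE => /ffunP/(_ w); rewrite ffunE.
rewrite memvE; apply/subv_bigcapP => s _; rewrite -memvE.
by apply/fixedSpaceP; rewrite lfunE; apply/ffunP => w; rewrite ffunE.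
Qed.

Definition xvar (I : finType) (i : I) : {mpoly F[#|{: I}|]} := 'X_(enum_rank i).

(* the projection of the d-th tensor power onto Sym^d(F^I) *)
Definition symclass d (I : finType) (t : tens d I) : {mpoly F[#|{: I}|]} :=
  \sum_w t w *: \prod_s xvar (w s).

Definition tensbox d (I J : finType) (a : tens d I) (b : tens d J) :
    tens d (I * J)%type :=
  [ffun w : {ffun 'I_d -> I * J} =>
     a [ffun s => (w s).1] * b [ffun s => (w s).2]].

(* A tensor representing the degree d part of the polynomial p: among the     *)
(* words with the same product of variables, only the one selected by pick    *)
(* carries the coefficient of that monomial.                                  *)
Definition word_mnm d (I : finType) (w : {ffun 'I_d -> I}) : 'X_{1..#|{: I}|} :=
  (\sum_s U_(enum_rank (w s)))%MM.

Definition word_can d (I : finType) (w : {ffun 'I_d -> I}) : {ffun 'I_d -> I} :=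
  odflt w [pick v | word_mnm v == word_mnm w].

Definition symlift d (I : finType) (p : {mpoly F[#|{: I}|]}) : tens d I :=
  [ffun w => if word_can w == w then p@_(word_mnm w) else 0].

(* Well defined on classes of tensors when b is symmetric: see symboxE.       *)
Definition symbox d (I J : finType) (p : {mpoly F[#|{: I}|]}) (b : tens d J) :
    {mpoly F[#|{: (I * J)%type}|]} :=
  symclass (tensbox (symlift d p) b).

End Tensors.

Section Box.
Context (F : fieldType) (d : nat).
Implicit Types I J : finType.

Lemma prod_xvar I (w : {ffun 'I_d -> I}) :
  \prod_s xvar F (w s) = 'X_[word_mnm w].
Proof. by rewrite /xvar mprodXE. Qed.

Lemma word_can_mnm I (w : {ffun 'I_d -> I}) : word_mnm (word_can w) = word_mnm w.
Proof. by rewrite /word_can; case: pickP => [v /eqP|_]. Qed.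

Lemma word_can_eq I (v w : {ffun 'I_d -> I}) :
  word_mnm v = word_mnm w -> word_can v = word_can w.
Proof.
move=> vw; rewrite /word_can vw; case: pickP => //= /(_ w).
by rewrite eqxx.
Qed.

Lemma word_can_idem I (w : {ffun 'I_d -> I}) : word_can (word_can w) = word_can w.
Proof. exact/word_can_eq/word_can_mnm. Qed.

Lemma word_mnm_permw I (v w : {ffun 'I_d -> I}) :
  word_mnm v = word_mnm w -> exists s : 'S_d, v = permw s w.
Proof.
move=> /mnmP vw.
have /tuple_permP [s sE] : perm_eq [tuple v i | i < d] [tuple w i | i < d].
  apply/allP => x _ /=; apply/eqP.
  have cE (u : {ffun 'I_d -> I}) :
      count_mem x [tuple u i | i < d] = word_mnm u (enum_rank x).
    rewrite -sum1_count big_tuple big_mkcond mnm_sumE; apply: eq_bigr => i _.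
    by rewrite tnth_mktuple mnm1E (inj_eq enum_rank_inj) /=; case: (u i == x).
  by rewrite !cE vw.
exists s; apply/ffunP => i; rewrite ffunE.
have := congr1 (fun t => nth (v i) t i) sE.
rewrite -!tnth_nth.
by rewrite !tnth_mktuple.
Qed.

Definition wordbox I J (w : {ffun 'I_d -> I}) (b : tens F d J) :
    {mpoly F[#|{: (I * J)%type}|]} :=
  \sum_v b v *: \prod_s xvar F (w s, v s).

Lemma wordbox_perm I J (s : 'S_d) (w : {ffun 'I_d -> I}) (b : tens F d J) :
  b \in symtens F d J -> wordbox (permw s w) b = wordbox w b.
Proof.
move=> /symtensP bS; rewrite /wordbox.
have inj : injective (@permw d J s).
  move=> v v' /ffunP vv'; apply/ffunP => i.
  by have := vv' (s^-1%g i); rewrite !ffunE permKV.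
rewrite (reindex_inj inj); apply: eq_bigr => v _ /=.
rewrite bS; congr (_ *: _); rewrite [RHS](reindex_inj (@perm_inj _ s)).
by apply: eq_bigr => i _; rewrite !ffunE.
Qed.

Lemma symclass_tensbox I J (a : tens F d I) (b : tens F d J) :
  symclass (tensbox a b) = \sum_w a w *: wordbox w b.
Proof.
rewrite /symclass /wordbox.
under [RHS]eq_bigr do rewrite scaler_sumr.
rewrite pair_big /=.
pose f (w : {ffun 'I_d -> I * J}) : {ffun 'I_d -> I} * {ffun 'I_d -> J} :=
  ([ffun s => (w s).1], [ffun s => (w s).2]).
pose g (p : {ffun 'I_d -> I} * {ffun 'I_d -> J}) : {ffun 'I_d -> I * J} :=
  [ffun s => (p.1 s, p.2 s)].
have fK : cancel f g by move=> w; apply/ffunP => i; rewrite !ffunE; case: (w i).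
have gK : cancel g f.
  by case=> u v; congr (_, _); apply/ffunP => i; rewrite !ffunE.
rewrite [RHS](reindex f) /=; last by exists g => ? _; [apply: fK|apply: gK].
apply: eq_bigr => w _; rewrite ffunE scalerA; congr (_ *: _).
by apply: eq_bigr => s _; rewrite !ffunE; case: (w s).
Qed.

Lemma mcoeff_symclass I (a : tens F d I) m :
  (symclass a)@_m = \sum_(w | word_mnm w == m) a w.
Proof.
rewrite /symclass raddf_sum [RHS]big_mkcond; apply: eq_bigr => w _ /=.
rewrite mcoeffZ prod_xvar mcoeffX.
by case: eqP => _; rewrite ?mulr1 ?mulr0.
Qed.

Lemma symclass_tensboxE I J (a : tens F d I) (b : tens F d J) :
  b \in symtens F d J ->
  symclass (tensbox a b) =
    \sum_(u | word_can u == u) (symclass a)@_(word_mnm u) *: wordbox u b.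
Proof.
move=> bS; rewrite symclass_tensbox.
rewrite (partition_big (@word_can d I) (fun u => word_can u == u)) /=; last first.
  by move=> w _; rewrite word_can_idem.
apply: eq_bigr => u /eqP uc; rewrite mcoeff_symclass scaler_suml.
have canE w : (word_can w == u) = (word_mnm w == word_mnm u).
  apply/eqP/eqP => [<-|/word_can_eq ->//]; by rewrite word_can_mnm.
rewrite (eq_bigl _ _ canE); apply: eq_bigr => w /eqP /word_mnm_permw [s ->].
by rewrite wordbox_perm.
Qed.

Lemma symliftE I (a : tens F d I) u : word_can u = u ->
  symlift d (symclass a) u = (symclass a)@_(word_mnm u).
Proof. by move=> uc; rewrite ffunE uc eqxx. Qed.

Lemma symboxE I J (a : tens F d I) (b : tens F d J) :
  b \in symtens F d J -> symbox (symclass a) b = symclass (tensbox a b).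
Proof.
move=> bS; rewrite [RHS]symclass_tensboxE // /symbox symclass_tensbox.
rewrite [RHS]big_mkcond; apply: eq_bigr => w _; rewrite ffunE.
by case: eqP => // _; rewrite scale0r.
Qed.

End Box.

(* The linear map e_j |-> \sum_i a i j e_i of F^I: its matrix in the          *)
(* enumeration of the variables xvar i, and its action on tensors.            *)
Section LinearMaps.
Context (F : fieldType).
Implicit Types I J : finType.

Definition idxmx I (a : I -> I -> F) : 'M[F]_#|{: I}| :=
  \matrix_(s, r) a (enum_val s) (enum_val r).

Definition tensact d I (a : I -> I -> F) (t : tens F d I) : tens F d I :=
  [ffun w : {ffun 'I_d -> I} =>
     \sum_(v : {ffun 'I_d -> I}) (\prod_s a (w s) (v s)) * t v].

Fact tensact_is_linear d I a : linear (@tensact d I a).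
Proof.
move=> c t u; apply/ffunP => w; rewrite !ffunE scaler_sumr -big_split.
apply: eq_bigr => v _; rewrite !ffunE mulrDr; congr (_ + _).
exact: mulrCA.
Qed.
HB.instance Definition _ d I a :=
  GRing.isLinear.Build F (tens F d I) (tens F d I) _ (tensact a)
    (@tensact_is_linear d I a).

Lemma eq_tensact d I (a c : I -> I -> F) :
  a =2 c -> @tensact d I a =1 tensact c.
Proof.
move=> ac t; apply/ffunP => w; rewrite !ffunE; apply: eq_bigr => v _.
by congr (_ * _); apply: eq_bigr => s _.
Qed.

Lemma tensact1 d I (t : tens F d I) : tensact (fun i j => (i == j)%:R) t = t.
Proof.
apply/ffunP => w; rewrite ffunE (bigD1 w) //=.
rewrite big1 ?mul1r => [|s _]; last by rewrite eqxx.
rewrite big1 ?addr0 // => v vw.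
have [s /negPf sF] : exists s, w s != v s.
  apply/existsP; rewrite -negb_forall; apply: contra vw => /forallP vw.
  by apply/eqP/ffunP => s; rewrite (eqP (vw s)).
by rewrite (bigD1 s) //= sF !mul0r.
Qed.

Lemma tensactM d I (a c : I -> I -> F) (t : tens F d I) :
  tensact a (tensact c t) = tensact (fun i j => \sum_k a i k * c k j) t.
Proof.
apply/ffunP => w; rewrite !ffunE.
under eq_bigr do rewrite ffunE big_distrr.
rewrite exchange_big; apply: eq_bigr => v _ /=.
rewrite bigA_distr_bigA big_distrl; apply: eq_bigr => u _ /=.
by rewrite mulrA -big_split.
Qed.

Lemma tensact_symtens d I (a : I -> I -> F) (t : tens F d I) :
  t \in symtens F d I -> tensact a t \in symtens F d I.
Proof.
move=> /symtensP tS; apply/symtensP => s w; rewrite !ffunE.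
have inj : injective (@permw d I s).
  move=> v v' /ffunP vv'; apply/ffunP => i.
  by have := vv' (s^-1%g i); rewrite !ffunE permKV.
rewrite (reindex_inj inj); apply: eq_bigr => v _ /=; rewrite tS; congr (_ * _).
rewrite [RHS](reindex_inj (@perm_inj _ s)).
by apply: eq_bigr => i _; rewrite !ffunE.
Qed.

Lemma symact_symclass d I (a : I -> I -> F) (t : tens F d I) :
  symact (idxmx a) (symclass t) = symclass (tensact a t).
Proof.
rewrite /symclass [LHS]linear_sum /=.
under [RHS]eq_bigr do rewrite ffunE scaler_suml.
rewrite exchange_big; apply: eq_bigr => v _ /=.
have -> : symact (idxmx a) (t v *: \prod_s xvar F (v s))
   = t v *: \prod_s symact (idxmx a) (xvar F (v s)).
  have -> : \prod_s symact (idxmx a) (xvar F (v s))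
    = symact (idxmx a) (\prod_s xvar F (v s)) by rewrite [RHS]rmorph_prod.
  exact: linearZ.
have XE i : symact (idxmx a) (xvar F i) = \sum_j a j i *: xvar F j.
  rewrite symactX (reindex _ (onW_bij _ (enum_rank_bij I))).
  by apply: eq_bigr => j _; rewrite mxE !enum_rankK.
under eq_bigr do rewrite XE.
rewrite bigA_distr_bigA scaler_sumr; apply: eq_bigr => w _ /=.
by rewrite scaler_prod scalerA mulrC.
Qed.

Lemma tensact_tensbox d I J (a : I -> I -> F) (c : J -> J -> F)
    (t : tens F d I) (u : tens F d J) :
  tensact (fun i j => a i.1 j.1 * c i.2 j.2) (tensbox t u)
  = tensbox (tensact a t) (tensact c u).
Proof.
apply/ffunP => w; rewrite !ffunE big_distrlr pair_big /=.
pose f (w : {ffun 'I_d -> I * J}) : {ffun 'I_d -> I} * {ffun 'I_d -> J} :=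
  ([ffun s => (w s).1], [ffun s => (w s).2]).
pose g (p : {ffun 'I_d -> I} * {ffun 'I_d -> J}) : {ffun 'I_d -> I * J} :=
  [ffun s => (p.1 s, p.2 s)].
have fK : cancel f g by move=> z; apply/ffunP => i; rewrite !ffunE; case: (z i).
have gK : cancel g f.
  by case=> x y; congr (_, _); apply/ffunP => i; rewrite !ffunE.
rewrite [RHS](reindex f) /=; last by exists g => ? _; [apply: fK|apply: gK].
apply: eq_bigr => z _; rewrite ffunE mulrACA -big_split; congr (_ * _).
by apply: eq_bigr => s _; rewrite !ffunE.
Qed.

Lemma idxmx1 I : idxmx (fun i j : I => (i == j)%:R) = 1%:M.
Proof. by apply/matrixP => s r; rewrite !mxE (inj_eq enum_val_inj). Qed.

Lemma idxmxM I (a c : I -> I -> F) :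
  idxmx a *m idxmx c = idxmx (fun i j => \sum_k a i k * c k j).
Proof.
apply/matrixP => s r; rewrite !mxE.
rewrite (reindex _ (onW_bij _ (enum_rank_bij I))).
by apply: eq_bigr => k _; rewrite !mxE enum_rankK.
Qed.

End LinearMaps.

(* The action of (g1, g2, g3) on F^l (x) F^l (x) F^2. *)
Section Pencils.
Context (F : fieldType) (l : nat).

Definition trimx (g1 g2 : 'M[F]_l) (g3 : 'M[F]_2) :
    'M[F]_#|{: 'I_l * 'I_l * 'I_2}| :=
  idxmx (fun i j => g1 i.1.1 j.1.1 * g2 i.1.2 j.1.2 * g3 i.2 j.2).

Lemma trimx1 : trimx 1%:M 1%:M 1%:M = 1%:M.
Proof.
rewrite -idxmx1; congr idxmx; apply/funext => -[[i1 i2] i3].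
apply/funext => -[[j1 j2] j3]; rewrite !mxE /= -!natrM !mulnb.
by rewrite !xpair_eqE.
Qed.

Lemma trimxM g1 g2 g3 h1 h2 h3 :
  trimx g1 g2 g3 *m trimx h1 h2 h3 = trimx (g1 *m h1) (g2 *m h2) (g3 *m h3).
Proof.
rewrite idxmxM; congr idxmx; apply/funext => -[[i1 i2] i3].
apply/funext => -[[j1 j2] j3]; rewrite !mxE /= big_distrlr pair_big big_distrlr pair_big /=.
by apply: eq_bigr => k _ /=; rewrite mulrACA (mulrACA (g1 _ _)).
Qed.

Definition detpoly : {mpoly F[#|{: 'I_l * 'I_l}|]} :=
  \det (\matrix_(i, j) xvar F (i, j)).

(* In 'I_2, ord0 stands for x and ord_max for y. *)
Definition xyword (k : nat) : {ffun 'I_l -> 'I_2} :=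
  [ffun i : 'I_l => if (i < k)%N then ord0 else ord_max].

Definition symF (k : nat) : tens F l 'I_2 :=
  \sum_(w in [set permw s (xyword k) | s : 'S_l]) etens F w.

Definition pencilM (k : nat) : {mpoly F[#|{: 'I_l * 'I_l * 'I_2}|]} :=
  symbox detpoly (symF k).

Lemma symF_coord k w :
  symF k w = (w \in [set permw s (xyword k) | s : 'S_l])%:R.
Proof.
rewrite /symF sum_ffunE; case: imsetP => [wS|wN].
  rewrite (bigD1 w) /=; last by apply/imsetP.
  rewrite ffunE eqxx big1 ?addr0 // => v /andP[_ /negPf vw].
  by rewrite ffunE eq_sym vw.
rewrite big1 // => v /imsetP vS; rewrite ffunE.
by case: eqP => // wv; case: wN; rewrite wv.
Qed.

Lemma symF_symtens k : symF k \in symtens F l 'I_2.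
Proof.
apply/symtensP => s w; rewrite !symF_coord; congr (nat_of_bool _)%:R.
apply/imsetP/imsetP => -[r _ rE].
  exists (s^-1 * r)%g => //; apply/ffunP => i; move/ffunP: rE => /(_ (s^-1%g i)).
  by rewrite !ffunE permM permKV.
by exists (s * r)%g => //; apply/ffunP => i; rewrite rE !ffunE permM.
Qed.

Definition dettens : tens F l ('I_l * 'I_l)%type :=
  \sum_(s : 'S_l) (-1) ^+ s *: etens F [ffun i => (i, s i)].

Lemma dettensE : symclass dettens = detpoly.
Proof.
rewrite /symclass /dettens /detpoly /determinant.
under eq_bigr do rewrite sum_ffunE scaler_suml.
rewrite exchange_big; apply: eq_bigr => s _ /=.
rewrite (bigD1 [ffun i => (i, s i)]) //= [X in _ + X]big1 ?addr0; last first.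
  by move=> w /negPf wF; rewrite !ffunE wF scaler0 scale0r.
rewrite !ffunE eqxx; have -> : (-1) ^+ s *: (1 : F^o) = (-1) ^+ s by exact: mulr1.
rewrite scaler_sign mulr_sign.
have -> : \prod_i xvar F ([ffun i0 => (i0, s i0)] i)
   = \prod_i (\matrix_(i, j) xvar F (i, j)) i (s i) :> {mpoly F[_]}.
  by apply: eq_bigr => i _; rewrite ffunE mxE.
by [].
Qed.

Lemma symact_detpoly (g1 g2 : 'M[F]_l) :
  symact (idxmx (fun i j : 'I_l * 'I_l => g1 i.1 j.1 * g2 i.2 j.2)) detpoly
  = (\det g1 * \det g2) *: detpoly.
Proof.
set a := idxmx _; pose X := \matrix_(i, j) xvar F (i, j) : 'M_l.
have -> : symact a detpoly = \det (map_mx (symact a) X) by rewrite det_map_mx.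
have -> : map_mx (symact a) X
   = (map_mx (@mpolyC _ F) g1)^T *m X *m map_mx (@mpolyC _ F) g2.
  apply/matrixP => i j; rewrite !mxE symactX.
  rewrite (reindex _ (onW_bij _ (enum_rank_bij _))).
  under [RHS]eq_bigr do rewrite mxE big_distrl.
  rewrite exchange_big pair_big; apply: eq_bigr => -[p q] _ /=.
  rewrite !mxE !enum_rankK /= -mul_mpolyC mpolyCM -!mulrA; congr (_ * _).
  exact: mulrC.
rewrite !det_mulmx det_tr !det_map_mx -mul_mpolyC mpolyCM.
by rewrite -!mulrA; congr (_ * _); exact: mulrC.
Qed.

Lemma symact_pencilM g1 g2 k :
  symact (trimx g1 g2 1%:M) (pencilM k) = (\det g1 * \det g2) *: pencilM k.
Proof.
have kS := symF_symtens k.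
rewrite /pencilM -dettensE symboxE // /trimx symact_symclass.
rewrite (tensact_tensbox (fun i j : 'I_l * 'I_l => g1 i.1 j.1 * g2 i.2 j.2)).
have -> : tensact (1%:M : 'M[F]_2) (symF k) = symF k.
  rewrite -[RHS]tensact1; apply: eq_tensact => i j; by rewrite mxE.
rewrite [LHS]symclass_tensboxE // [in RHS]symclass_tensboxE // scaler_sumr.
rewrite -symact_symclass dettensE symact_detpoly; apply: eq_bigr => u _.
by rewrite mcoeffZ scalerA.
Qed.

End Pencils.

Lemma map_trimx (F K : fieldType) (f : {rmorphism F -> K}) l
    (g1 g2 : 'M[F]_l) (g3 : 'M[F]_2) :
  map_mx f (trimx g1 g2 g3) = trimx (map_mx f g1) (map_mx f g2) (map_mx f g3).
Proof. by apply/matrixP => s r; rewrite !mxE !rmorphM. Qed.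

Lemma map_pencilM (F K : fieldType) (f : {rmorphism F -> K}) l k :
  map_mpoly f (pencilM F l k) = pencilM K l k.
Proof.
rewrite /pencilM -!dettensE !symboxE ?symF_symtens // /symclass raddf_sum.
apply: eq_bigr => w _ /=; rewrite map_mpolyZ !prod_xvar map_mpolyX.
congr (_ *: _); rewrite !ffunE rmorphM; congr (_ * _).
  rewrite !sum_ffunE rmorph_sum; apply: eq_bigr => s _; rewrite !ffunE.
  by rewrite [LHS]rmorphM rmorph_sign rmorph_nat.
by rewrite !symF_coord rmorph_nat.
Qed.

(* The symmetric algebra of a subspace U of V, in the basis vbasis U: symgen  *)
(* embeds U as its linear part, and resmx f is the matrix of the restriction  *)
(* to U of a linear map f that stabilizes U.                                  *)
Section SubspacePowers.
Context (F : fieldType) (V : vectType F) (U : {vspace V}).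

Definition symgen (v : V) : {mpoly F[\dim U]} :=
  \sum_i coord (vbasis U) i v *: 'X_i.

Definition resmx (f : V -> V) : 'M[F]_(\dim U) :=
  \matrix_(s, r) coord (vbasis U) s (f (vbasis U)`_r).

Lemma coord_resmx (f : {linear V -> V}) s v : v \in U ->
  coord (vbasis U) s (f v) = \sum_r resmx f s r * coord (vbasis U) r v.
Proof.
move=> /coord_vbasis vE; rewrite {1}vE !linear_sum.
by apply: eq_bigr => r _; rewrite !linearZ mxE /= mulrC.
Qed.

Lemma symact_symgen (f : {linear V -> V}) v : v \in U ->
  symact (resmx f) (symgen v) = symgen (f v).
Proof.
move=> vU; rewrite /symgen [LHS]linear_sum /=.
under eq_bigr => r _.
  have -> : symact (resmx f) (coord (vbasis U) r v *: 'X_r)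
    = coord (vbasis U) r v *: symact (resmx f) 'X_r by exact: linearZ.
  rewrite symactX scaler_sumr.
  over.
rewrite exchange_big; apply: eq_bigr => s _ /=.
rewrite coord_resmx // scaler_suml; apply: eq_bigr => r _.
by rewrite scalerA mulrC.
Qed.

Lemma resmx_id (f : V -> V) : f =1 id -> resmx f = 1%:M.
Proof.
move=> fE; apply/matrixP => s r; rewrite !mxE fE coord_free 1?eq_sym //.
exact: basis_free (vbasisP U).
Qed.

Lemma resmx_comp (f g : {linear V -> V}) (h : V -> V) :
    (forall v, v \in U -> g v \in U) -> (forall v, h v = f (g v)) ->
  resmx h = resmx f *m resmx g.
Proof.
move=> gU hE; apply/matrixP => s r; rewrite mxE hE coord_resmx; last first.
  by apply/gU/vbasis_mem/mem_nth; rewrite size_tuple.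
by rewrite mxE; apply: eq_bigr => t _; rewrite !mxE.
Qed.

End SubspacePowers.

(* A representation of GL_n(F): only the invertible matrices are relevant.    *)
Record glrep (F : fieldType) (n : nat) (V : lmodType F) := GLRep {
  glact :> 'M[F]_n -> V -> V;
  glact_linear : forall g, g \in unitmx -> linear (glact g);
  glact1 : forall v, glact 1%:M v = v;
  glactM : forall g h, g \in unitmx -> h \in unitmx ->
    forall v, glact (g *m h) v = glact g (glact h v)
}.

Definition glrep_iso (F : fieldType) (n : nat) (V W : lmodType F)
    (rV : glrep n V) (rW : glrep n W) (f : V -> W) : Prop :=
  [/\ linear f, bijective f
    & forall g, g \in unitmx -> forall v, f (rV g v) = rW g (f v)].

(* Sym^m Sym_l F^2 *)
Section SymSym.
Context (F : fieldType) (l m : nat).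
Local Notation U := (symtens F l 'I_2).

Definition symtensmx (g : 'M[F]_2) : 'M[F]_(\dim U) := resmx U (tensact g).

Lemma symtensmx1 : symtensmx 1%:M = 1%:M.
Proof.
apply: resmx_id => t /=; rewrite -[RHS]tensact1.
by apply: eq_tensact => i j; rewrite mxE.
Qed.

Lemma symtensmxM g h : symtensmx (g *m h) = symtensmx g *m symtensmx h.
Proof.
apply: resmx_comp => t; first exact: tensact_symtens.
by rewrite /= tensactM; apply: eq_tensact => i j; rewrite mxE.
Qed.

Definition symsym_act (g : 'M[F]_2) (p : dhomog (\dim U) F m) :
    dhomog (\dim U) F m :=
  DHomog (symact_homog (symtensmx g) (dhomog_is_dhomog p)).

Fact symsym_act_linear g : g \in unitmx -> linear (symsym_act g).
Proof. by move=> _ c p q; apply: val_inj; exact: linearP. Qed.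

Fact symsym_act1 p : symsym_act 1%:M p = p.
Proof. by apply: val_inj; rewrite /= symtensmx1 symact1. Qed.

Fact symsym_actM g h : g \in unitmx -> h \in unitmx ->
  forall p, symsym_act (g *m h) p = symsym_act g (symsym_act h p).
Proof. by move=> _ _ p; apply: val_inj; rewrite /= symtensmxM symactM. Qed.

Definition symsym_rep : glrep 2 (dhomog (\dim U) F m) :=
  GLRep symsym_act_linear symsym_act1 symsym_actM.

End SymSym.

(* Invariance is tested over Fbar, the invariants have coefficients in F.     *)
(* sl_algebra is the algebra of all of them, sl_part d its part in Sym^d.     *)
Section Invariants.
Context (F : fieldType) (Fbar : closedFieldType) (iota : {rmorphism F -> Fbar}).
Context (l : nat).
Local Notation N := #|{: 'I_l * 'I_l * 'I_2}|.

Definition sl_invariant (p : {mpoly F[N]}) : Prop :=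
  forall g1 g2 : 'M[Fbar]_l, \det g1 = 1 -> \det g2 = 1 ->
    symact (trimx g1 g2 1%:M) (map_mpoly iota p) = map_mpoly iota p.

Definition slinv : {pred {mpoly F[N]}} := [pred p | `[< sl_invariant p >]].

Lemma slinvP p : reflect (sl_invariant p) (p \in slinv).
Proof. exact: asboolP. Qed.

Fact slinv_subalg : GRing.subsemialg_closed slinv.
Proof.
split.
- by apply/slinvP => g1 g2 _ _; rewrite !rmorph1.
- split; first by apply/slinvP => g1 g2 _ _; rewrite !raddf0.
  move=> p q /slinvP pI /slinvP qI; apply/slinvP => g1 g2 d1 d2.
  rewrite raddfD; have -> (a b : {mpoly Fbar[N]}) A : symact A (a + b) = symact A a + symact A b.
    exact: raddfD.
  rewrite (pI g1 g2 d1 d2) (qI g1 g2 d1 d2); reflexivity.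
- move=> c p /slinvP pI; apply/slinvP => g1 g2 d1 d2; rewrite map_mpolyZ.
  have -> (a : {mpoly Fbar[N]}) A x : symact A (x *: a) = x *: symact A a.
    exact: linearZ.
  rewrite (pI g1 g2 d1 d2); reflexivity.
- move=> p q /slinvP pI /slinvP qI; apply/slinvP => g1 g2 d1 d2.
  rewrite rmorphM; have -> (a b : {mpoly Fbar[N]}) A : symact A (a * b) = symact A a * symact A b.
    exact: rmorphM.
  rewrite (pI g1 g2 d1 d2) (qI g1 g2 d1 d2); reflexivity.
Qed.
HB.instance Definition _ :=
  GRing.isSubalgClosed.Build F {mpoly F[N]} slinv slinv_subalg.

Record sl_algebra := SLAlgebra {
  sl_algebra_val :> {mpoly F[N]}; _ : sl_algebra_val \in slinv }.
HB.instance Definition _ := [isSub for sl_algebra_val].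
HB.instance Definition _ := [Choice of sl_algebra by <:].
HB.instance Definition _ := [SubChoice_isSubAlgebra of sl_algebra by <:].
HB.instance Definition _ :=
  [SubNzRing_isSubComNzRing of sl_algebra by <:].

Definition slinv_homog (d : nat) : {pred dhomog N F d} :=
  [pred p | mpoly_of_dhomog p \in slinv].

Fact slinv_homog_submod d : GRing.subsemimod_closed (@slinv_homog d).
Proof.
split; first split.
- by rewrite inE; exact: rpred0.
- by move=> p q pI qI; rewrite inE; exact: rpredD.
by move=> c p pI; rewrite inE; exact: rpredZ.
Qed.
HB.instance Definition _ d :=
  GRing.isSubmodClosed.Build F (dhomog N F d) (@slinv_homog d)
    (@slinv_homog_submod d).

Record sl_part (d : nat) := SLPart {
  sl_part_val :> dhomog N F d; _ : sl_part_val \in @slinv_homog d }.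
HB.instance Definition _ d := [isSub for @sl_part_val d].
HB.instance Definition _ d := [Choice of sl_part d by <:].
HB.instance Definition _ d := [SubChoice_isSubLmodule of sl_part d by <:].

End Invariants.
Arguments slinv {F Fbar} iota l.

Section InvariantRep.
Context (F : fieldType) (Fbar : closedFieldType) (iota : {rmorphism F -> Fbar}).
Context (l d : nat).
Local Notation N := #|{: 'I_l * 'I_l * 'I_2}|.

Fact slinv_act (g : 'M[F]_2) (p : {mpoly F[N]}) :
  p \in slinv iota l -> symact (trimx 1%:M 1%:M g) p \in slinv iota l.
Proof.
move=> /slinvP pI; apply/slinvP => g1 g2 d1 d2.
rewrite map_symact map_trimx !map_mx1 -symactM trimxM mul1mx !mulmx1.
rewrite -[in RHS](pI g1 g2 d1 d2) -symactM trimxM !mul1mx mulmx1.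
reflexivity.
Qed.

Definition sl_part_act (g : 'M[F]_2) (p : sl_part iota l d) : sl_part iota l d :=
  @SLPart _ _ iota l d
    (DHomog (symact_homog (trimx 1%:M 1%:M g) (dhomog_is_dhomog p)))
    (slinv_act g (valP p)).

Fact sl_part_act_linear g : g \in unitmx -> linear (sl_part_act g).
Proof. by move=> _ c p q; do 2!apply: val_inj; exact: linearP. Qed.

Fact sl_part_act1 p : sl_part_act 1%:M p = p.
Proof. by do 2!apply: val_inj; rewrite /= trimx1 symact1. Qed.

Fact sl_part_actM g h : g \in unitmx -> h \in unitmx ->
  forall p, sl_part_act (g *m h) p = sl_part_act g (sl_part_act h p).
Proof.
by move=> _ _ p; do 2!apply: val_inj; rewrite /= -symactM trimxM !mul1mx.
Qed.

Definition sl_part_rep : glrep 2 (sl_part iota l d) :=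
  GLRep sl_part_act_linear sl_part_act1 sl_part_actM.

Fact pencilM_slinv k : pencilM F l k \in slinv iota l.
Proof.
apply/slinvP => g1 g2 d1 d2.
by rewrite map_pencilM symact_pencilM d1 d2 mulr1 scale1r.
Qed.

Definition sl_pencilM (k : nat) : sl_algebra iota l :=
  SLAlgebra (pencilM_slinv k).

End InvariantRep.

(* The degree d component of the re-graded algebra of invariants is the part  *)
(* of degree l * d in the variables.                                          *)
Section GradedPart.
Context (F : fieldType) (Fbar : closedFieldType) (iota : {rmorphism F -> Fbar}).
Context (l n : nat) (K : sl_algebra iota l -> {mpoly F[n]}).

Definition sl_graded : Prop :=
  forall d (p : sl_algebra iota l),
    sl_algebra_val p \is (l * d).-homog -> K p \is d.-homog.

Definition sl_part_algebra d (p : sl_part iota l d) : sl_algebra iota l :=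
  SLAlgebra (valP p : mpoly_of_dhomog (sl_part_val p) \in slinv iota l).

Definition graded_part (Kgr : sl_graded) (m : nat) (p : sl_part iota l (l * m)) :
    dhomog n F m :=
  DHomog (Kgr m (sl_part_algebra p) (dhomog_is_dhomog (sl_part_val p))).

End GradedPart.
Arguments graded_part {F Fbar iota l n K} Kgr m p.

(* Main.v *)
(** The inverse of K can be written down: let Phi be the algebra morphism from
    Sym Sym_l F^2 that sends a symmetric tensor v, taken as a generator, to
    det_l [x] v.  As [x] is functorial in both factors and det_l is fixed by
    the first two, Phi is GL_2-equivariant on generators, hence everywhere.
    Since the F(k) span Sym_l F^2, the hypothesis on K says that K \o Phi is
    the identity on generators, so that K = Phi^-1 is equivariant. *)
From HB Require Import structures.
Require Import Defs.
From mathcomp Require Import all_boot all_order all_fingroup all_algebra.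
From mathcomp Require Import mpoly.

Set Implicit Arguments.
Unset Strict Implicit.
Unset Printing Implicit Defensive.

Import GRing.Theory.
Local Open Scope ring_scope.

(** * Orbits of two-letter words under permutation of positions *)

Section Counting.
Context {l : nat}.
Implicit Types w : {ffun 'I_l -> 'I_2}.

Definition xcount w : nat := \sum_s (w s == ord0).

Lemma xcount_permw s w : xcount (permw s w) = xcount w.
Proof.
rewrite /xcount [RHS](reindex_inj (@perm_inj _ s)).
by apply: eq_bigr => i _; rewrite ffunE.
Qed.

Lemma xcount_le w : (xcount w <= l)%N.
Proof.
rewrite -[X in (_ <= X)%N]card_ord -sum1_card.
by apply: leq_sum => i _; case: eqP.
Qed.

Lemma xcount_xyword k : (k <= l)%N -> xcount (xyword l k) = k.
Proof.
move=> kl; rewrite -[RHS]card_ord -sum1_card (big_ord_widen _ (fun=> 1%N) kl).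
rewrite [RHS]big_mkcond; apply: eq_bigr => i _.
by rewrite ffunE; case: ifP.
Qed.

Lemma word_mnm_xcount w i :
  word_mnm w i = if enum_val i == ord0 then xcount w else (l - xcount w)%N.
Proof.
rewrite /word_mnm mnm_sumE.
have -> : (\sum_s U_(enum_rank (w s)) i = \sum_s (w s == enum_val i))%N%MM.
  apply: eq_bigr => s _; rewrite mnm1E; congr nat_of_bool.
  by rewrite -{1}(enum_valK i) (inj_eq enum_rank_inj).
case: eqP => [-> //|/eqP i0].
(* Moving [xcount w] to the left avoids truncated subtraction; each position then counts exactly
   once, as x or as y. *)
apply: (canRL (addnK _)).
rewrite -big_split /= -[RHS]card_ord -sum1_card; apply: eq_bigr => s _.
by move: (w s) (enum_val i) i0 => [[|[|//]] ?] [[|[|//]] ?].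
Qed.

(** The number of letters x determines the monomial of a word, and words with equal monomials are
    rearrangements of each other. *)
Lemma permw_xyword w : exists s, w = permw s (xyword l (xcount w)).
Proof.
apply: word_mnm_permw; apply/mnmP => i.
by rewrite !word_mnm_xcount xcount_xyword ?xcount_le.
Qed.

End Counting.

(** * The morphism Phi and its equivariance *)

Section PencilMorphism.
Context (F : fieldType) (l : nat).
Local Notation U := (symtens F l 'I_2).
Local Notation N := #|{: 'I_l * 'I_l * 'I_2}|.

(** The bound matters: for k > l the word [xyword l k] has only l letters x. *)
Lemma symF_xcount k w : (k <= l)%N -> symF F l k w = (xcount w == k)%:R.
Proof.
move=> kl; rewrite symF_coord; congr (nat_of_bool _)%:R.
apply/imsetP/eqP => [[s _ ->]|<-]; first by rewrite xcount_permw xcount_xyword.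
by have [s ws] := permw_xyword w; exists s.
Qed.

(** A symmetric tensor is constant on orbits of words, so its coefficients can be read off at the
    representatives [xyword l k]. *)
Lemma symtens_symF v : v \in U ->
  v = \sum_(k < l.+1) v (xyword l k) *: symF F l k.
Proof.
move=> /symtensP vS; apply/ffunP => w; rewrite sum_ffunE.
have wl : (xcount w < l.+1)%N by rewrite ltnS xcount_le.
rewrite (bigD1 (Ordinal wl)) //= big1 => [|k kw].
  rewrite addr0 ffunE symF_xcount ?xcount_le // eqxx.
  have [s {1}->] := permw_xyword w; rewrite vS.
  by rewrite -[LHS]mulr1.
rewrite ffunE symF_xcount -1?ltnS //.
case: eqP => [wk|_]; last exact: mulr0.
by case/eqP: kw; apply: val_inj.
Qed.

Definition detbox (v : tens F l 'I_2) : {mpoly F[N]} := symbox (detpoly F l) v.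

(** This holds on all tensors, symmetric or not, because the lift of [detpoly] inside [symbox] does
    not depend on v. *)
Fact detbox_is_linear : linear detbox.
Proof.
move=> c u v; rewrite /detbox /symbox /symclass scaler_sumr -big_split.
apply: eq_bigr => w _; rewrite !ffunE /= scalerA -scalerDl mulrDr.
by congr ((_ + _) *: _); exact: mulrCA.
Qed.
HB.instance Definition _ :=
  GRing.isLinear.Build F (tens F l 'I_2) {mpoly F[N]} _ detbox detbox_is_linear.

Lemma detbox_homog v : detbox v \is l.-homog.
Proof.
apply: rpred_sum => w _; apply: rpredZ; rewrite prod_xvar dhomogX /= /word_mnm.
rewrite mdeg_sum (eq_bigr (fun=> 1%N)) => [|s _]; last exact: mdeg1.
by rewrite sum_nat_const card_ord muln1.
Qed.

Lemma symact_detbox g v : v \in U ->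
  symact (trimx 1%:M 1%:M g) (detbox v) = detbox (tensact g v).
Proof.
(* Symmetry of v and of its image allows the lift of [detpoly] to be replaced by [dettens]; the
   action then splits over the two factors of [tensbox]. *)
move=> vU; rewrite /detbox -dettensE !symboxE ?tensact_symtens //.
rewrite symact_symclass.
rewrite (tensact_tensbox (fun i j : 'I_l * 'I_l => 1%:M i.1 j.1 * 1%:M i.2 j.2)).
congr (symclass (tensbox _ _)); rewrite -[RHS]tensact1; apply: eq_tensact.
by move=> [i1 i2] [j1 j2]; rewrite !mxE -natrM mulnb xpair_eqE.
Qed.

(** This is Phi: the variable ['X_i] stands for the i-th vector of [vbasis U]. *)
Definition pencil_morph (q : {mpoly F[\dim U]}) : {mpoly F[N]} :=
  q \mPo [tuple detbox (vbasis U)`_i | i < \dim U].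
HB.instance Definition _ := GRing.LRMorphism.copy pencil_morph
  (@comp_mpoly (\dim U) F N [tuple detbox (vbasis U)`_i | i < \dim U]).

Lemma pencil_morphX i : pencil_morph 'X_i = detbox (vbasis U)`_i.
Proof. by rewrite /pencil_morph comp_mpolyXU -tnth_nth tnth_mktuple. Qed.

Lemma vbasis_nth_mem (i : 'I_(\dim U)) : (vbasis U)`_i \in U.
Proof. by apply/vbasis_mem/mem_nth; rewrite size_tuple. Qed.

(** Frees Phi from the chosen basis, so that it can be evaluated at F(k) and at transformed basis
    vectors. *)
Lemma pencil_morph_symgen v : v \in U -> pencil_morph (symgen U v) = detbox v.
Proof.
move=> vU; rewrite [in RHS](coord_vbasis vU) /symgen.
rewrite (linear_sum pencil_morph) (linear_sum detbox); apply: eq_bigr => i _.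
by rewrite (linearZ_LR pencil_morph) (linearZ_LR detbox) /= pencil_morphX.
Qed.

Lemma symgen_vbasis (i : 'I_(\dim U)) : symgen U (vbasis U)`_i = 'X_i.
Proof.
rewrite /symgen (bigD1 i) //= coord_free ?(basis_free (vbasisP U)) // eqxx.
rewrite scale1r big1 ?addr0 // => j ji.
by rewrite coord_free ?(basis_free (vbasisP U)) // eq_sym (negPf ji) scale0r.
Qed.

Lemma pencil_morph_homog m q :
  q \is m.-homog -> pencil_morph q \is (l * m).-homog.
Proof.
move=> /dhomogP hq; rewrite (mpolyE q) (linear_sum pencil_morph) big_seq.
apply: rpred_sum => n /hq <-; rewrite linearZ; apply: rpredZ.
rewrite /= mpolyXE_id (rmorph_prod pencil_morph) mdegE big_distrr /=.
apply: (big_ind2 (fun p d => p \is d.-homog)) => [|p d p' d'|i _].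
- exact: dhomog1.
- exact: dhomogM.
by rewrite (rmorphXn pencil_morph) /= pencil_morphX; apply: dhomogMn; apply: detbox_homog.
Qed.

Lemma pencil_morph_symact g q :
  pencil_morph (symact (symtensmx l g) q) =
  symact (trimx 1%:M 1%:M g) (pencil_morph q).
Proof.
rewrite -[LHS]/((pencil_morph \o symact (symtensmx l g)) q).
rewrite -[RHS]/((symact (trimx 1%:M 1%:M g) \o pencil_morph) q).
apply: lrmorph_ext => i /=; rewrite pencil_morphX symact_detbox ?vbasis_nth_mem //.
(* Read as a generator, the variable is moved by g as a tensor, which matches the functoriality of
   [detbox]. *)
rewrite -symgen_vbasis symact_symgen ?vbasis_nth_mem // pencil_morph_symgen //.
exact/tensact_symtens/vbasis_nth_mem.
Qed.

(** * Phi as a morphism into the algebra of invariants *)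

Context (Fbar : closedFieldType) (iota : {rmorphism F -> Fbar}).

(** The F(k) span U, and their images are the invariants [pencilM]. *)
Lemma detbox_slinv v : v \in U -> detbox v \in slinv iota l.
Proof.
move=> /symtens_symF ->; rewrite (linear_sum detbox); apply: rpred_sum => k _.
by rewrite (linearZ_LR detbox); apply/rpredZ/pencilM_slinv.
Qed.

Lemma pencil_morph_slinv q : pencil_morph q \in slinv iota l.
Proof.
rewrite (mpolyE q) (linear_sum pencil_morph); apply: rpred_sum => n _.
rewrite linearZ; apply: rpredZ; rewrite mpolyXE_id (rmorph_prod pencil_morph).
apply: rpred_prod => i _; rewrite (rmorphXn pencil_morph) /= pencil_morphX.
exact/rpredX/detbox_slinv/vbasis_nth_mem.
Qed.

Definition sl_pencil_morph (q : {mpoly F[\dim U]}) : sl_algebra iota l :=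
  SLAlgebra (pencil_morph_slinv q).

Fact sl_pencil_morph_is_linear : linear sl_pencil_morph.
Proof. by move=> c p q; apply: val_inj; exact: linearP. Qed.
Fact sl_pencil_morph_is_monoid_morphism : monoid_morphism sl_pencil_morph.
Proof.
split=> [|p q]; apply: val_inj; first exact: (rmorph1 pencil_morph).
exact: (rmorphM pencil_morph).
Qed.
HB.instance Definition _ := GRing.isLinear.Build F {mpoly F[\dim U]}
  (sl_algebra iota l) _ sl_pencil_morph sl_pencil_morph_is_linear.
HB.instance Definition _ := GRing.isMonoidMorphism.Build {mpoly F[\dim U]}
  (sl_algebra iota l) sl_pencil_morph sl_pencil_morph_is_monoid_morphism.

Lemma sl_pencil_morphK (K : {lrmorphism sl_algebra iota l -> {mpoly F[\dim U]}}) :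
    (forall k : nat, (k <= l)%N ->
       K (sl_pencilM iota l k) = symgen U (symF F l k)) ->
  cancel sl_pencil_morph K.
Proof.
move=> K_gen q; rewrite -[LHS]/((K \o sl_pencil_morph) q) -[RHS]/(idfun q).
apply: lrmorph_ext => i /=; set v := (vbasis U)`_i.
have vE := symtens_symF (vbasis_nth_mem i); rewrite -/v in vE.
(* The hypothesis on [K] concerns the F(k), so the basis vector v is expanded in them. *)
have -> : sl_pencil_morph 'X_i =
    \sum_(k < l.+1) (v (xyword l k) : F) *: sl_pencilM iota l k.
  apply: val_inj; rewrite raddf_sum -[LHS]/(pencil_morph 'X_i).
  rewrite pencil_morphX -/v [in LHS]vE (linear_sum detbox); apply: eq_bigr => k _.
  by rewrite (linearZ_LR detbox).
rewrite -symgen_vbasis -/v [in RHS]vE.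
rewrite (linear_sum K) /symgen.
under eq_bigr => k _ do rewrite (linearZ_LR K) /= K_gen -1?ltnS // scaler_sumr.
rewrite exchange_big; apply: eq_bigr => j _ /=.
rewrite linear_sum scaler_suml; apply: eq_bigr => k _.
by rewrite [in RHS]linearZ scalerA.
Qed.

End PencilMorphism.

(** * Transfer of equivariance from Phi to its inverse [K] *)

Theorem theorem4p3
  (F : fieldType) (Fbar : closedFieldType) (iota : {rmorphism F -> Fbar})
  (Fbar_alg : forall z : Fbar, algebraicOver iota z)
  (l m : nat) (l_gt0 : (0 < l)%N) (m_gt0 : (0 < m)%N)
  (K : {lrmorphism sl_algebra iota l -> {mpoly F[\dim (symtens F l 'I_2)]}})
  (K_bij : bijective K)
  (K_graded : sl_graded K)
  (K_gen : forall k : nat, (k <= l)%N ->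
     K (sl_pencilM iota l k) = symgen (symtens F l 'I_2) (symF F l k)) :
  glrep_iso (sl_part_rep iota l (l * m)) (symsym_rep F l m)
    (graded_part K_graded m).
Proof.
have PK := sl_pencil_morphK K_gen.
(* A right inverse of a bijection is also a left inverse. *)
have KP : cancel K (sl_pencil_morph iota) by apply/(bij_can_sym K_bij).
split.
- move=> c p q; apply: val_inj => /=; rewrite -linearP; congr (K _).
  exact: val_inj.
(* Phi multiplies degrees by l and takes invariant values, so it restricts to an inverse in degree
   m. *)
- exists (fun q : dhomog _ F m => @SLPart _ _ iota l (l * m)
    (DHomog (pencil_morph_homog (dhomog_is_dhomog q)))
    (pencil_morph_slinv iota q)) => [p|q].
    do 2!apply: val_inj; exact: (congr1 val (KP (sl_part_algebra p))).
  apply: val_inj; rewrite /= -[RHS]PK; congr (K _); exact: val_inj.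
(* With the right side written as [K] of its image under Phi, equivariance of Phi suffices. *)
move=> g _ p; apply: val_inj => /=; rewrite -[RHS]PK; congr (K _).
apply: val_inj; rewrite /= pencil_morph_symact; congr symact.
exact: (congr1 val (esym (KP (sl_part_algebra p)))).
Qed.
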